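(* Let $\varphi$ be an indecomposable $\mathfrak{S}_\infty$-central state on the group $\Gamma\wr\mathfrak{S}_\infty$ with GNS-representation $\pi_\varphi$. Then for each $g\in\Gamma\wr\mathfrak{S}_\infty$ the limit of the operators $\pi_\varphi(\omega_n g\omega_n)$ as $n\to\infty$ exists in the weak operator topology, and $$w\text{-}\lim_{n\to\infty}\pi_\varphi(\omega_n g\omega_n)=\varphi(g)\,I.$$
   Context: $\mathfrak{S}_\infty$ is the (discrete) group of all bijections of $\mathbb{N}=\{1,2,\ldots\}$ moving only finitely many points. $\Gamma$ is a separable topological group with identity $e$; $\Gamma^\infty_e$ is the group of sequences $\gamma=(\gamma_1,\gamma_2,\ldots)$ in $\Gamma$ with only finitely many $\gamma_i\neq e$, with the inductive limit topology of the $\Gamma^n$. $\Gamma\wr\mathfrak{S}_\infty=\Gamma^\infty_e\rtimes\mathfrak{S}_\infty$ carries the product topology; $\Gamma_e^\infty,\mathfrak{S}_\infty$ are regarded as subgroups, and $s(\gamma_1,\gamma_2,\ldots)s^{-1}=(\gamma_{s^{-1}(1)},\gamma_{s^{-1}(2)},\ldots)$. A state is a continuous positive definite function $\varphi$ with $\varphi(e)=1$; it is indecomposable if its GNS-representation $\pi_\varphi$ generates a factor, and $\mathfrak{S}_\infty$-central if $\varphi(gs)=\varphi(sg)$ for all $g\in\Gamma\wr\mathfrak{S}_\infty$, $s\in\mathfrak{S}_\infty$. The permutation $\omega_n\in\mathfrak{S}_\infty$ is defined by $\omega_n(i)=i+n$ for $i\le n$, $\omega_n(i)=i-n$ for $n<i\le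 2n$, and $\omega_n(i)=i$ for $i>2n$. *)

(* Defs.v *)
From HB Require Import structures.
From mathcomp Require Import all_boot all_order all_algebra.
From mathcomp Require Import all_classical all_reals all_analysis.
From mathcomp Require Export complex.
From mathcomp Require Import zify.

Set Implicit Arguments.
Unset Strict Implicit.
Unset Printing Implicit Defensive.

Import Order.TTheory GRing.Theory Num.Theory.
Import numFieldNormedType.Exports.

Local Open Scope classical_set_scope.
Local Open Scope ring_scope.

HB.mixin Record isTopologicalGroup G of Topological G & Group G := {
  mulg_continuous : continuous (fun x : (G * G)%type => (x.1 * x.2)%g) ;
  invg_continuous : continuous (fun x : G => x^-1%g)
}.

#[short(type="topologicalGroupType")]
HB.structure Definition TopologicalGroup :=
  {G of isTopologicalGroup G & Topological G & Group G}.

Definition separable (T : topologicalType) :=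
  exists2 D : set T, countable D & dense D.

(* The permuted points 1, 2, 3, ... are numbered from 0: nat stands for
   {1, 2, ...} through i |-> i + 1, here, in omega_fun and in finseq. *)

Record Sinf := MkSinf {
  Sinf_fun :> nat -> nat ;
  Sinf_bij : bijective Sinf_fun ;
  Sinf_fin : finite_set [set i | Sinf_fun i != i]
}.

Lemma SinfP (s t : Sinf) : s =1 t -> s = t.
Proof.
case: s t => [f fb ff] [g gb gf] /= /funext fg; subst g.
by congr MkSinf; exact: Prop_irrelevance.
Qed.

HB.instance Definition _ := gen_eqMixin Sinf.
HB.instance Definition _ := gen_choiceMixin Sinf.

Definition Sinf_inv_fun (s : Sinf) (i : nat) : nat := xget 0%N [set j | s j = i].

Lemma Sinf_inv_funK (s : Sinf) : cancel (Sinf_inv_fun s) s.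
Proof.
move=> i; case: (Sinf_bij s) => t st ts.
by apply: (xgetPex 0%N (P := [set j | s j = i])); exists (t i); exact: ts.
Qed.

Lemma Sinf_funK (s : Sinf) : cancel s (Sinf_inv_fun s).
Proof. by move=> i; apply: (bij_inj (Sinf_bij s)); rewrite Sinf_inv_funK. Qed.

Lemma Sinf_one_fin : finite_set [set i : nat | id i != i].
Proof. by rewrite (_ : [set _ | _] = set0)// -subset0 => i /=; rewrite eqxx. Qed.

Definition Sinf_one : Sinf := MkSinf (Bijective (fun=> erefl) (fun=> erefl)) Sinf_one_fin.

Lemma Sinf_inv_fin (s : Sinf) : finite_set [set i | Sinf_inv_fun s i != i].
Proof.
apply: sub_finite_set (Sinf_fin s) => i /= /eqP ni; apply/eqP => si; apply: ni.
by rewrite -[in LHS]si Sinf_funK.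
Qed.

Definition Sinf_inv (s : Sinf) : Sinf :=
  MkSinf (Bijective (Sinf_inv_funK s) (Sinf_funK s)) (Sinf_inv_fin s).

Lemma Sinf_mul_fin (s t : Sinf) : finite_set [set i | (s \o t) i != i].
Proof.
apply: (@sub_finite_set _ _ ([set i | s i != i] `|` [set i | t i != i])).
  move=> i /=; case: (eqVneq (t i) i) => [->|]; [by left|by right].
by rewrite finite_setU; split; exact: Sinf_fin.
Qed.

Definition Sinf_mul (s t : Sinf) : Sinf :=
  MkSinf (bij_comp (Sinf_bij s) (Sinf_bij t)) (Sinf_mul_fin s t).

Lemma Sinf_mulA : associative Sinf_mul. Proof. by move=> s t u; exact: SinfP. Qed.
Lemma Sinf_mul1 : left_id Sinf_one Sinf_mul. Proof. by move=> s; exact: SinfP. Qed.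
Lemma Sinf_mulr1 : right_id Sinf_one Sinf_mul. Proof. by move=> s; exact: SinfP. Qed.
Lemma Sinf_mulV : left_inverse Sinf_one Sinf_inv Sinf_mul.
Proof. by move=> s; apply: SinfP => i /=; rewrite Sinf_funK. Qed.
Lemma Sinf_mulrV : right_inverse Sinf_one Sinf_inv Sinf_mul.
Proof. by move=> s; apply: SinfP => i /=; rewrite Sinf_inv_funK. Qed.

HB.instance Definition _ := isGroup.Build Sinf
  Sinf_mulA Sinf_mul1 Sinf_mulr1 Sinf_mulV Sinf_mulrV.

HB.instance Definition _ := Topological.copy Sinf (discrete_topology Sinf).

Definition omega_fun (n i : nat) : nat :=
  if (i < n)%N then (i + n)%N else if (i < n.*2)%N then (i - n)%N else i.

Lemma omega_funK n : involutive (omega_fun n).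
Proof.
move=> i; rewrite /omega_fun.
case: (ltnP i n) => h1; last case: (ltnP i n.*2) => h2; do !case: ifP; lia.
Qed.

Lemma omega_fin n : finite_set [set i | omega_fun n i != i].
Proof.
apply: (@sub_finite_set _ _ `I_(n.*2)) => //= i /=.
by rewrite /omega_fun; do !case: ifP; lia.
Qed.

Definition omega (n : nat) : Sinf :=
  MkSinf (Bijective (omega_funK n) (omega_funK n)) (omega_fin n).

Record finseq (G : groupType) := MkFinseq {
  finseq_fun :> nat -> G ;
  finseq_fin : finite_set [set i | finseq_fun i != 1%g]
}.

Lemma finseqP (G : groupType) (x y : finseq G) : x =1 y -> x = y.
Proof.
case: x y => [f ff] [g gf] /= /funext fg; subst g.
by congr MkFinseq; exact: Prop_irrelevance.
Qed.

HB.instance Definition _ (G : groupType) := gen_eqMixin (finseq G).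
HB.instance Definition _ (G : groupType) := gen_choiceMixin (finseq G).

Section FinseqGroup.
Variable G : groupType.
Local Open Scope group_scope.
Implicit Types x y : finseq G.

Lemma finseq_one_fin : finite_set [set i : nat | (fun=> 1 : G) i != 1].
Proof. by rewrite (_ : [set _ | _] = set0)// -subset0 => i /=; rewrite eqxx. Qed.

Definition finseq_one : finseq G := MkFinseq finseq_one_fin.

Lemma finseq_inv_fin x : finite_set [set i | (x i)^-1 != 1].
Proof.
apply: sub_finite_set (finseq_fin x) => i /= ni; apply: contraNN ni => /eqP ->.
by rewrite invg1.
Qed.

Definition finseq_inv x : finseq G := MkFinseq (finseq_inv_fin x).

Lemma finseq_mul_fin x y : finite_set [set i | x i * y i != 1].
Proof.
apply: (@sub_finite_set _ _ ([set i | x i != 1] `|` [set i | y i != 1])).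
  by move=> i /=; case: (eqVneq (x i) 1) => [->|]; [rewrite mul1g; right|left].
by rewrite finite_setU; split; exact: finseq_fin.
Qed.

Definition finseq_mul x y : finseq G := MkFinseq (finseq_mul_fin x y).

Lemma finseq_mulA : associative finseq_mul.
Proof. by move=> x y z; apply: finseqP => i /=; rewrite mulgA. Qed.
Lemma finseq_mul1 : left_id finseq_one finseq_mul.
Proof. by move=> x; apply: finseqP => i /=; rewrite mul1g. Qed.
Lemma finseq_mulr1 : right_id finseq_one finseq_mul.
Proof. by move=> x; apply: finseqP => i /=; rewrite mulg1. Qed.
Lemma finseq_mulV : left_inverse finseq_one finseq_inv finseq_mul.
Proof. by move=> x; apply: finseqP => i /=; rewrite mulVg. Qed.
Lemma finseq_mulrV : right_inverse finseq_one finseq_inv finseq_mul.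
Proof. by move=> x; apply: finseqP => i /=; rewrite mulgV. Qed.

HB.instance Definition _ := isGroup.Build (finseq G)
  finseq_mulA finseq_mul1 finseq_mulr1 finseq_mulV finseq_mulrV.

(* (x_0, ..., x_(n-1), 1, 1, ...) *)
Definition pad_fun n (x : 'I_n -> G) (i : nat) : G :=
  if insub i is Some j then x j else 1.

Lemma pad_fin n (x : 'I_n -> G) : finite_set [set i | pad_fun x i != 1].
Proof.
apply: (@sub_finite_set _ _ `I_n) => //= i /=.
by rewrite /pad_fun; case: insubP => [j -> //|_]; rewrite eqxx.
Qed.

Definition pad n (x : 'I_n -> G) : finseq G := MkFinseq (pad_fin x).

End FinseqGroup.

(* Inductive limit topology: the final topology for the inclusions of the finite
   powers G^n, each carrying the product topology. *)
Section FinseqTopology.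
Variable G : topologicalGroupType.

Definition finseq_open : set_system (finseq G) := [set U |
  forall n, open [set x : prod_topology (fun _ : 'I_n => G) | U (pad x)]].

Lemma finseq_openT : finseq_open setT. Proof. by move=> n; exact: openT. Qed.
Lemma finseq_openI : setI_closed finseq_open.
Proof. by move=> U V oU oV n; exact: openI (oU n) (oV n). Qed.
Lemma finseq_open_bigcup (I : Type) (f : I -> set (finseq G)) :
  (forall i, finseq_open (f i)) -> finseq_open (\bigcup_i f i).
Proof.
move=> of_ n; rewrite (_ : [set x | _] =
  \bigcup_i [set x : prod_topology (fun _ : 'I_n => G) | f i (pad x)]) //.
by apply: bigcup_open => i _; exact: of_.
Qed.

HB.instance Definition _ := isOpenTopological.Build (finseq G)
  finseq_openT finseq_openI finseq_open_bigcup.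

End FinseqTopology.

Section Permute.
Variable G : groupType.
Local Open Scope group_scope.

Lemma permute_fin (s : Sinf) (x : finseq G) :
  finite_set [set i | x (Sinf_inv_fun s i) != 1].
Proof.
rewrite (_ : [set _ | _] = s @` [set i | x i != 1]).
  exact: finite_image (finseq_fin x).
apply/seteqP; split => [i /= xi|i /= [j xj <-]]; last by rewrite Sinf_funK.
by exists (Sinf_inv_fun s i) => //; rewrite Sinf_inv_funK.
Qed.

Definition permute (s : Sinf) (x : finseq G) : finseq G :=
  MkFinseq (permute_fin s x).

Lemma permute1 (x : finseq G) : permute 1 x = x.
Proof.
by apply: finseqP => i /=; congr (x _); exact: (@Sinf_inv_funK (1 : Sinf) i).
Qed.

Lemma permuteM (s t : Sinf) (x : finseq G) :
  permute (s * t) x = permute s (permute t x).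
Proof.
apply: finseqP => i /=; congr (x _); apply: (bij_inj (Sinf_bij (s * t))).
rewrite Sinf_inv_funK [RHS](_ : _ = s (t (Sinf_inv_fun t (Sinf_inv_fun s i))))//.
by rewrite !Sinf_inv_funK.
Qed.

Lemma permute_mul (s : Sinf) (x y : finseq G) :
  permute s (x * y) = permute s x * permute s y.
Proof. exact: finseqP. Qed.

Lemma permute_one (s : Sinf) : permute s 1 = 1 :> finseq G.
Proof. exact: finseqP. Qed.

End Permute.

(* The pair (x, s) is the product x s, see wreathE; G^oo and Sinf are embedded by
   in_seq and in_perm. *)
Definition wreath (G : groupType) : Type := (finseq G * Sinf)%type.

HB.instance Definition _ (G : groupType) :=
  Choice.copy (wreath G) (finseq G * Sinf)%type.
HB.instance Definition _ (G : topologicalGroupType) :=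
  Topological.copy (wreath G) (finseq G * Sinf)%type.

Section WreathGroup.
Variable G : groupType.
Local Open Scope group_scope.
Implicit Types g h k : wreath G.

Definition wreath_one : wreath G := (1, 1).
Definition wreath_mul g h : wreath G := (g.1 * permute g.2 h.1, g.2 * h.2).
Definition wreath_inv g : wreath G := (permute g.2^-1 g.1^-1, g.2^-1).

Lemma wreath_mulA : associative wreath_mul.
Proof.
by move=> g h k; rewrite /wreath_mul /= permute_mul permuteM !mulgA.
Qed.
Lemma wreath_mul1 : left_id wreath_one wreath_mul.
Proof. by case=> x s; rewrite /wreath_mul /= permute1 !mul1g. Qed.
Lemma wreath_mulr1 : right_id wreath_one wreath_mul.
Proof. by case=> x s; rewrite /wreath_mul /= permute_one !mulg1. Qed.
Lemma wreath_mulV : left_inverse wreath_one wreath_inv wreath_mul.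
Proof.
case=> x s; rewrite /wreath_mul /wreath_inv /= -permute_mul !mulVg.
by rewrite permute_one.
Qed.
Lemma wreath_mulrV : right_inverse wreath_one wreath_inv wreath_mul.
Proof.
case=> x s; rewrite /wreath_mul /wreath_inv /= -permuteM !mulgV.
by rewrite permute1 mulgV.
Qed.

HB.instance Definition _ := isGroup.Build (wreath G)
  wreath_mulA wreath_mul1 wreath_mulr1 wreath_mulV wreath_mulrV.

Definition in_seq (x : finseq G) : wreath G := (x, 1).
Definition in_perm (s : Sinf) : wreath G := (1, s).

Lemma wreathE x s : (x, s) = in_seq x * in_perm s :> wreath G.
Proof.
rewrite [RHS](_ : _ = (x * permute 1 1, 1 * s))//.
by rewrite permute1 mulg1 mul1g.
Qed.

Lemma in_perm_conj s x : in_perm s * in_seq x * (in_perm s)^-1 =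
  in_seq (permute s x).
Proof.
rewrite [LHS](_ : _ = (1 * permute s x * permute (s * 1) (permute s^-1 1^-1),
   s * 1 * s^-1))//.
by rewrite mulg1 mul1g -permuteM mulgV permute1 invg1 mulg1.
Qed.

End WreathGroup.

Arguments in_perm {G} s.
Arguments in_seq {G} x.

(* The scalar field C is R[i]; the norm of H takes its values in R[i] and is the
   one of the inner product by dot_norm, so that completeness is inherited from
   CompleteNormedModule.  The inner product is linear in its first argument. *)
HB.mixin Record isHilbert (R : realType) (H : Type)
    of CompleteNormedModule R[i] H := {
  dot : H -> H -> R[i] ;
  dot_linear : forall (a : R[i]) (x y z : H),
    dot (a *: x + y) z = a * dot x z + dot y z ;
  dot_conj : forall x y : H, dot y x = (dot x y)^* ;
  dot_norm : forall x : H, dot x x = `|x| ^+ 2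
}.

#[short(type="hilbertType")]
HB.structure Definition Hilbert (R : realType) :=
  {H of isHilbert R H & CompleteNormedModule R[i] H}.

Section Operators.
Variables (R : realType) (H : hilbertType R).
Implicit Types (S M : set (H -> H)) (T : H -> H).

Definition bounded_operator T := linear T /\ continuous T.

Definition commutant S : set (H -> H) :=
  [set T | bounded_operator T /\ forall A, S A -> T \o A = A \o T].

Definition is_factor M :=
  M `&` commutant M = [set T | exists a : R[i], T = ( *:%R a)].

Definition wot_cvg (T_ : nat -> H -> H) T :=
  forall x y : H,
    (fun n => dot (T_ n x) y : R[i]^o) @ \oo --> (dot (T x) y : R[i]^o).

End Operators.

Record unitary_rep (W : groupType) (R : realType) (H : hilbertType R) := {
  rep_fun :> W -> {linear H -> H} ;
  rep_one : forall x, rep_fun 1%g x = x ;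
  rep_mul : forall g h x, rep_fun (g * h)%g x = rep_fun g (rep_fun h x) ;
  rep_dot : forall g x y, dot (rep_fun g x) (rep_fun g y) = dot x y
}.

Section Representation.
Variables (W : groupType) (R : realType) (H : hilbertType R).
Variable pi : unitary_rep W H.

Definition cyclic_vector (xi : H) :=
  closure [set v : H | exists n (c : 'I_n -> R[i]) (g : 'I_n -> W),
    v = \sum_i c i *: pi (g i) xi] = setT.

(* pi(W)'': the von Neumann algebra generated by pi(W), since pi(W) is closed
   under adjoints. *)
Definition vN_algebra : set (H -> H) :=
  commutant (commutant (range (fun g => pi g : H -> H))).

End Representation.

Definition positive_definite (W : groupType) (R : realType) (phi : W -> R[i]) :=
  forall n (c : 'I_n -> R[i]) (g : 'I_n -> W),
    0 <= \sum_i \sum_j (c i)^* * c j * phi ((g i)^-1 * g j)%g.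

(* The GNS-representation is determined by phi up to unitary equivalence; GNS phi
   is the type of its realisations. *)
Record GNS (W : groupType) (R : realType) (phi : W -> R[i]) := {
  gns_space : hilbertType R ;
  gns_rep :> unitary_rep W gns_space ;
  gns_vector : gns_space ;
  gns_cyclic : cyclic_vector gns_rep gns_vector ;
  gns_coef : forall g, phi g = dot (gns_rep g gns_vector) gns_vector
}.

(* A property of phi read off its GNS-representation; it does not depend on the
   realisation. *)
Definition indecomposable (W : groupType) (R : realType) (phi : W -> R[i])
  (pi : GNS phi) := is_factor (vN_algebra pi).

Section States.
Variables (R : realType) (G : topologicalGroupType) (phi : wreath G -> R[i]).

Definition is_state :=
  [/\ continuous (phi : wreath G -> R[i]^o),
      positive_definite phi & phi 1%g = 1].

Definition Sinf_central := forall (g : wreath G) (s : Sinf),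
  phi (g * in_perm s)%g = phi (in_perm s * g)%g.

End States.

(* Main.v *)
From HB Require Import structures.
Require Import Defs.
From mathcomp Require Import all_boot all_order all_algebra.
From mathcomp Require Import all_classical all_reals all_analysis.
From mathcomp Require Import zify ring lra.

(** The idea is that the operators [pi (omega n * g * omega n)] act further and
    further away from any given position, so that their weak limit must be
    central in the von Neumann algebra generated by [pi], hence a scalar since
    this algebra is a factor.

    Put [g_n = omega n * g * omega n].  If [g] is supported on the first [N]
    positions, then [g_n] is supported on the positions [n, ..., n + N - 1] as soon
    as [N <= n].

    - Existence of the limit.  Fix [h] and [k].  For large [n] the element
      [g_(n+1)] is the conjugate of [g_n] by the permutation [shift n N], which
      slides the block [n, ..., n + N - 1] by one and commutes with [h] and [k].
      As [phi] is invariant under conjugation by permutations,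
      [phi (k^-1 * g_n * h)], the matrix coefficient of [pi g_n] between
      [pi h xi] and [pi k xi], does not depend on [n] from some rank on
      ([central_coef_stationary]).  The vectors [pi h xi] are total and the
      operators [pi g_n] are contractions, as are their adjoints, so a weak limit
      [E] exists on the whole space ([wot_limit]); it is produced by the Riesz
      representation theorem ([riesz]).

    - The limit is scalar.  Everything in the commutant of [pi] commutes with
      each [pi g_n], hence with [E], so [E] lies in the bicommutant.  Given [h],
      the elements [g_n] and [h] have disjoint supports for large [n], so [E]
      commutes with [pi h] as well.  Thus [E] lies in the centre, and [E = a I]
      ([asymptotically_central_wot_limit]).

    - The scalar is [phi g], because [phi g_n = phi g] for all [n] and
      [phi g_n] is the coefficient of [pi g_n] at the unit vector [xi]. *)

Set Implicit Arguments.
Unset Strict Implicit.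
Unset Printing Implicit Defensive.

Import Order.TTheory GRing.Theory Num.Theory.
Import numFieldNormedType.Exports.

Local Open Scope classical_set_scope.
Local Open Scope ring_scope.

(** * Inner products *)

Section InnerProduct.
Variables (R : realType) (H : hilbertType R).
Implicit Types (x y z : H) (a : R[i]).

Lemma dot0l z : dot (0 : H) z = 0.
Proof.
have := @dot_linear R H 1 0 0 z.
by rewrite scaler0 add0r mul1r -[X in X = _]addr0 => /addrI.
Qed.

Lemma dotDl x y z : dot (x + y) z = dot x z + dot y z.
Proof. by rewrite -[x]scale1r dot_linear scale1r mul1r. Qed.

Lemma dotZl a x z : dot (a *: x) z = a * dot x z.
Proof. by rewrite -[a *: x]addr0 dot_linear dot0l addr0. Qed.

Lemma dotNl x z : dot (- x) z = - dot x z.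
Proof. by rewrite -scaleN1r dotZl mulN1r. Qed.

Lemma dotBl x y z : dot (x - y) z = dot x z - dot y z.
Proof. by rewrite dotDl dotNl. Qed.

Lemma dotDr x y z : dot x (y + z) = dot x y + dot x z.
Proof. by rewrite dot_conj dotDl rmorphD /= -!dot_conj. Qed.

Lemma dotNr x z : dot x (- z) = - dot x z.
Proof. by rewrite dot_conj dotNl rmorphN /= -dot_conj. Qed.

Lemma dotBr x y z : dot x (y - z) = dot x y - dot x z.
Proof. by rewrite dotDr dotNr. Qed.

Lemma dotZr a x z : dot x (a *: z) = a^* * dot x z.
Proof. by rewrite dot_conj dotZl rmorphM /= -dot_conj. Qed.

Lemma dot_inj x y : (forall z, dot z x = dot z y) -> x = y.
Proof.
move=> xy; apply/eqP; rewrite -subr_eq0 -normr_eq0 -sqrf_eq0 -dot_norm.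
by rewrite dotBr xy subrr.
Qed.

(** Expanding [0 <= `|b *: x - a *: y| ^+ 2] with [a = dot x y] and
    [b = `|y| ^+ 2] gives [0 <= b * (b * `|x| ^+ 2 - `|a| ^+ 2)]. *)
Lemma cauchy_schwarz x y : `|dot x y| <= `|x| * `|y|.
Proof.
have [->|y0] := eqVneq y 0.
  by rewrite dot_conj dot0l rmorph0 normr0 mulr_ge0.
rewrite -(@ler_pXn2r _ 2) ?nnegrE ?mulr_ge0// exprMn.
set a := dot x y; set b := `|y| ^+ 2.
have b0 : 0 < b by rewrite exprn_gt0// normr_gt0.
have bR : b^* = b by apply: conj_Creal; rewrite gtr0_real.
have : 0 <= dot (b *: x - a *: y) (b *: x - a *: y).
  by rewrite dot_norm exprn_ge0.
rewrite dotBl !dotBr !dotZl !dotZr bR (dot_conj x y) !dot_norm -/a -/b.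
rewrite (_ : _ - _ = b * (`|x| ^+ 2 * b - `|a| ^+ 2)); last by rewrite normCK; ring.
by rewrite pmulr_rge0// subr_ge0.
Qed.

Lemma dot_cvgl (u : nat -> H) x y : u @ \oo --> x ->
  (fun n => dot (u n) y : R[i]^o) @ \oo --> (dot x y : R[i]^o).
Proof.
move=> ux; apply/cvgrPdist_le => e e0.
have d0 : 0 < e / (`|y| + 1) by rewrite divr_gt0// ltr_wpDl.
move/cvgrPdist_le : ux => /(_ _ d0); apply: filterS => n un.
rewrite -dotBl (le_trans (cauchy_schwarz _ _))//.
rewrite (le_trans (ler_wpM2r _ un))// mulrAC ler_pdivrMr ?ltr_wpDl//.
by rewrite ler_wpM2l// ?lerDl// ltW.
Qed.

End InnerProduct.

(** * Completeness *)

Lemma cauchy_seq_cvg (K : numFieldType) (V : completeNormedModType K)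
    (u : nat -> V) :
  (forall e : K, 0 < e -> exists N, forall m n, (N <= m)%N -> (N <= n)%N ->
    `|u m - u n| <= e) -> cvgn u.
Proof.
move=> uC; apply: cauchy_cvg; apply/cauchyP => e e0.
have [N uN] := uC (e / 2) (divr_gt0 e0 (ltr0Sn _ _)).
exists (u N); exists N => // n /= Nn; rewrite -ball_normE /=.
by rewrite (le_lt_trans (uN N n _ _))// gtr_pMr// invf_lt1// ltr1n.
Qed.

(** Completeness of the complex numbers follows from that of the reals, since the
    real and imaginary parts are contractions. *)
Lemma complex_cauchy_cvg (R : realType) (c : nat -> R[i]^o) :
  (forall e : R[i], 0 < e -> exists N, forall m n, (N <= m)%N -> (N <= n)%N ->
    `|c m - c n| <= e) -> cvgn c.
Proof.
move=> cC.
have ReE (x y : R[i]) : `|complex.Re x - complex.Re y|%:C%C <= `|x - y|.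
  by rewrite (_ : _ - _ = complex.Re (x - y)) ?normc_ge_Re//; case: x y => [? ?] [].
have ImE (x y : R[i]) : `|complex.Im x - complex.Im y|%:C%C <= `|x - y|.
  rewrite (_ : _ - _ = complex.Im (x - y)); last by case: x y => [? ?] [].
  case: (x - y) => a b; rewrite normc_def /= lecR -sqrtr_sqr ler_wsqrtr//.
  by rewrite lerDr sqr_ge0.
have reC (f : R[i] -> R) : (forall x y, `|f x - f y|%:C%C <= `|x - y|) ->
    cvgn (f \o c).
  move=> fL; apply: cauchy_seq_cvg => e e0.
  have [|N cN] := cC e%:C%C; first by rewrite ltcR.
  by exists N => m n Nm Nn; rewrite -lecR (le_trans (fL _ _))// cN.
have /cvg_ex[/= a ca] := reC _ ReE.
have /cvg_ex[/= b cb] := reC _ ImE.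
apply/cvg_ex; exists (Complex a b); apply/cvgrPdist_le => e e0.
have eE : e = (complex.Re e)%:C%C by rewrite RRe_real// gtr0_real.
rewrite eE; have {}e0 : 0 < complex.Re e / 2 by rewrite divr_gt0// -ltcR -eE.
move/cvgrPdist_le : ca => /(_ _ e0) ca; move/cvgrPdist_le : cb => /(_ _ e0).
apply: filterS2 ca => n /=; case: (c n) => p q /= pa qb.
have -> : (Complex a b - Complex p q : R[i]) = (a - p)%:C%C + 'i%C * (b - q)%:C%C.
  by rewrite [LHS]complexE.
have normR (r : R) : `|r%:C%C| = `|r|%:C%C.
  by rewrite normc_def /= expr0n addr0 sqrtr_sqr.
rewrite (le_trans (ler_normD _ _))// normrM !normR complexiE normCi mul1r.
by rewrite [X in _ <= X%:C%C]splitr rmorphD lerD// lecR.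
Qed.

(** * The Riesz representation theorem *)

Section Riesz.
Variables (R : realType) (H : hilbertType R).

Let ReD (a b : R[i]) : complex.Re (a + b) = complex.Re a + complex.Re b.
Proof. by case: a b => [? ?] []. Qed.

Let ReZ (t : R) (a : R[i]) : complex.Re (t%:C%C * a) = t * complex.Re a.
Proof. by case: a => a b /=; rewrite mul0r subr0. Qed.

Let ReJ (a : R[i]) : complex.Re a^* = complex.Re a.
Proof. by case: a. Qed.

Let normE (V : normedZmodType R[i]) (y : V) : `|y| = (complex.Re `|y|)%:C%C.
Proof. by rewrite RRe_real// normr_real. Qed.

(** The representing vector minimises [J y = `|y| ^+ 2 - 2 Re (f y)], which is
    bounded below because [f] is.  By the parallelogram identity every minimising
    sequence is Cauchy.  Near-minimality of [J] in the direction [y] forces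
    [Re (dot (u n) y)] towards [Re (f y)]; passing to the limit and replacing [y]
    by ['i *: y] recovers [f y] itself. *)
Lemma riesz (f : H -> R[i]) (C : R[i]) :
  linear (f : H -> R[i]^o) -> (forall y, `|f y| <= C * `|y|) ->
  exists z, forall y, f y = dot y z.
Proof.
move=> flin fC.
have fD y z : f (y + z) = f y + f z.
  by have := flin 1 y z; rewrite !scale1r.
have f0 : f 0 = 0 by apply/eqP; rewrite -normr_le0 (le_trans (fC 0))// normr0 mulr0.
have fZ a y : f (a *: y) = a * f y.
  by have := flin a y 0; rewrite f0 !addr0.
pose d (y z : H) := complex.Re (dot y z); pose g y := complex.Re (f y).
have dDl x y z : d (x + y) z = d x z + d y z by rewrite /d dotDl ReD.
have dC x y : d x y = d y x by rewrite /d dot_conj ReJ.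
have dZl t x y : d (t%:C%C *: x) y = t * d x y by rewrite /d dotZl ReZ.
have dDr x y z : d x (y + z) = d x y + d x z by rewrite !(dC x) dDl.
have dZr t x y : d x (t%:C%C *: y) = t * d x y by rewrite !(dC x) dZl.
have gD x y : g (x + y) = g x + g y by rewrite /g fD ReD.
have gZ t x : g (t%:C%C *: x) = t * g x by rewrite /g fZ ReZ.
have dn y : d y y = complex.Re `|y| ^+ 2.
  by rewrite /d dot_norm normE -rmorphXn.
have gn y : `|g y| <= complex.Re C * complex.Re `|y|.
  have := le_trans (normc_ge_Re (f y)) (fC y).
  rewrite {1}(normE y) lecE /= => /andP[_].
  by case: (C) => a b /=; rewrite mulr0 subr0.
pose J y := d y y - 2 * g y.
(* Completing the square: [J y >= (`|y| - C) ^+ 2 - C ^+ 2]. *)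
have Jlb : lbound (range J) (- complex.Re C ^+ 2).
  move=> _ [y _ <-]; rewrite /J dn; have := gn y; rewrite ler_norml => /andP[_ gy].
  have := sqr_ge0 (complex.Re `|y| - complex.Re C); nra.
have Jinf : has_inf (range J).
  by split; [exists (J 0), 0 | exists (- complex.Re C ^+ 2)].
set m := inf (range J).
have mJ y : m <= J y by apply: ge_inf; [exists (- complex.Re C ^+ 2) | exists y].
have /choice[u Ju] (n : nat) : exists y, J y < m + n.+1%:R^-1.
  have n0 : 0 < n.+1%:R^-1 :> R by rewrite invr_gt0 ltr0n.
  by have [_ [y _ <-] Jy] := inf_adherent n0 Jinf; exists y.
(* [J (u a)] and [J (u b)] are compared with [J] at the midpoint. *)
have uC a b : d (u a - u b) (u a - u b) <= 2 * (a.+1%:R^-1 + b.+1%:R^-1).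
  have := mJ ((2^-1)%:C%C *: (u a + u b)); have := Ju a; have := Ju b.
  have -> : u a - u b = u a + (-1)%:C%C *: u b by rewrite rmorphN scaleN1r.
  rewrite /J !(gZ, gD, dZl, dZr, dDl, dDr) (dC (u b) (u a)).
  by move: (a.+1%:R^-1 : R) (b.+1%:R^-1 : R) => p q; lra.
have /cvg_ex[/= z uz] : cvgn u.
  apply: cauchy_seq_cvg => e e0.
  have e0' : 0 < complex.Re e by rewrite -ltcR RRe_real ?gtr0_real.
  have [N Ne] : exists N, 4 * N.+1%:R^-1 <= complex.Re e ^+ 2.
    have e4 : 0 < complex.Re e ^+ 2 / 4 by rewrite divr_gt0// exprn_gt0.
    have [N _ /(_ N) Ne] := near_infty_natSinv_lt (PosNum e4).
    by exists N; rewrite mulrC -ler_pdivlMr// ltW// Ne/=.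
  exists N => a b Na Nb; rewrite (normE (_ - _)) -(RRe_real (gtr0_real e0)) lecR.
  rewrite -(@ler_pXn2r _ 2) ?nnegrE//; last 2 first.
  - by rewrite -ler0c -normE.
  - exact: ltW.
  rewrite -dn (le_trans (uC a b))// (le_trans _ Ne)//.
  have : a.+1%:R^-1 <= N.+1%:R^-1 :> R by rewrite lef_pV2 ?posrE ?ltr0n// ler_nat.
  have : b.+1%:R^-1 <= N.+1%:R^-1 :> R by rewrite lef_pV2 ?posrE ?ltr0n// ler_nat.
  by move: (a.+1%:R^-1 : R) (b.+1%:R^-1 : R) (N.+1%:R^-1 : R) => p q r; lra.
(* The polynomial [t |-> J (u n + t y) - J (u n)] is at least [- n.+1^-1];
   evaluating it at [t = - n.+1^-1 / w], with [w] half of its linear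
   coefficient, bounds [w]. *)
have gd y n : (d (u n) y - g y) ^+ 2 <= n.+1%:R^-1 * d y y.
  have p0 : 0 < n.+1%:R^-1 :> R by rewrite invr_gt0 ltr0n.
  have q0 : 0 <= d y y by rewrite dn sqr_ge0.
  have [->|w0] := eqVneq (d (u n) y - g y) 0.
    by rewrite expr0n mulr_ge0// ltW.
  set w := d (u n) y - g y in w0 *; set p := n.+1%:R^-1 in p0 *.
  have := mJ (u n + (- (p / w))%:C%C *: y); have := Ju n; rewrite -/p.
  rewrite /J !(gZ, gD, dZl, dZr, dDl, dDr) (dC y (u n)).
  have -> : d (u n) y = w + g y by rewrite /w subrK.
  set t := p / w.
  have pE : p = t * w by rewrite /t divfK.
  have w2 : 0 < w ^+ 2 by rewrite exprn_even_gt0.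
  move=> h1 h2.
  have pt : p < t * (t * d y y).
    by move: (d y y) (d (u n) (u n)) (g (u n)) (g y) h1 h2 => *; nra.
  rewrite -(ler_pM2l p0) pE.
  have -> : t * w * (t * w * d y y) = w ^+ 2 * (t * (t * d y y)) by ring.
  by rewrite -pE mulrC ler_pM2l// ltW.
have gz y : d z y = g y.
  apply: (@cvg_unique _ (@norm_hausdorff _ R^o) ((fun n => d (u n) y : R^o) @ \oo)).
    apply/cvgrPdist_le => e e0.
    have e0' : 0 < e%:C%C :> R[i] by rewrite ltcR.
    have /cvgrPdist_le/(_ _ e0') := @dot_cvgl _ _ u z y uz.
    apply: filterS => n; rewrite -lecR; apply: le_trans.
    rewrite (_ : _ - _ = complex.Re (dot z y - dot (u n) y)) ?normc_ge_Re//.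
    by rewrite /d; case: (dot z y) (dot (u n) y) => [? ?] [].
  apply/cvgrPdist_le => e e0.
  have q1 : 0 < d y y + 1 by rewrite ltr_wpDl// dn sqr_ge0.
  have e1 : 0 < e ^+ 2 / (d y y + 1) by rewrite divr_gt0// exprn_gt0.
  apply: filterS (near_infty_natSinv_lt (PosNum e1)) => n /= ne.
  rewrite distrC -(@ler_pXn2r _ 2) ?nnegrE ?(ltW e0)// real_normK ?num_real//.
  rewrite (le_trans (gd y n))//.
  move: ne; rewrite ltr_pdivlMr// => /ltW; apply: le_trans.
  by rewrite ler_wpM2l ?invr_ge0 ?ler0n// lerDl.
exists z => y; rewrite [RHS]dot_conj; have := gz y; have := gz ('i%C *: y).
rewrite /d /g dotZr fZ; case: (f y) (dot z y) => a b [p q] /=.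
rewrite /= => ? ?; congr Complex; lra.
Qed.
End Riesz.

(** * Weak limits of vectors and operators *)

Lemma cvg_lincomb (K : numFieldType) (k : K) (c d : nat -> K) (l m : K) :
  (c : nat -> K^o) @ \oo --> (l : K^o) -> (d : nat -> K^o) @ \oo --> (m : K^o) ->
  (fun n => k * c n + d n : K^o) @ \oo --> (k * l + m : K^o).
Proof. by move=> cl dm; apply: cvgD dm; apply: cvgM cl; exact: cvg_cst. Qed.

Section WeakLimits.
Variables (R : realType) (H : hilbertType R).

Definition total_family (I : Type) (e : I -> H) :=
  closure [set x : H | exists n (c : 'I_n -> R[i]) (i : 'I_n -> I),
    x = \sum_j c j *: e (i j)] = setT.

Lemma cvg_conjC (c : nat -> R[i]^o) (l : R[i]^o) : c @ \oo --> l ->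
  (fun n => (c n)^* : R[i]^o) @ \oo --> (l^* : R[i]^o).
Proof.
move=> /cvgrPdist_le cl; apply/cvgrPdist_le => e /cl; apply: filterS => n.
by rewrite -rmorphB norm_conjC.
Qed.

Lemma cvg_norm_le (c : nat -> R[i]^o) (l : R[i]^o) (r : R[i]) : c @ \oo --> l ->
  (forall n, `|c n| <= r) -> `|l| <= r.
Proof.
move=> cl cr; have rR : r \is Num.real by rewrite ger0_real// (le_trans _ (cr 0%N)).
rewrite real_leNgt//; apply/negP; rewrite -subr_gt0 => d0.
move/cvgrPdist_lt : cl => /(_ _ d0) [N _ /(_ N (leqnn N))] /= lN.
have := le_lt_trans (ler_normD (l - c N) (c N)) (ltr_leD lN (cr N)).
by rewrite !subrK ltxx.
Qed.

(** The bounded sequence [v] has convergent inner products with the span of [e] by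
    linearity, then with every vector by approximation; the limit is a bounded
    linear functional, represented by the weak limit of [v]. *)
Lemma weak_limit (I : Type) (e : I -> H) (v : nat -> H) (C : R[i]) :
  total_family e ->
  (forall n, `|v n| <= C) ->
  (forall i, cvgn (fun n => dot (e i) (v n) : R[i]^o)) ->
  exists w, forall x, (fun n => dot x (v n) : R[i]^o) @ \oo --> (dot x w : R[i]^o).
Proof.
move=> etot vC ecv.
have C0 : 0 <= C by rewrite (le_trans _ (vC 0%N)).
have dotvC x n : `|dot x (v n)| <= C * `|x|.
  by rewrite mulrC (le_trans (cauchy_schwarz _ _))// ler_wpM2l.
have cv x : cvgn (fun n => dot x (v n) : R[i]^o).
  apply: complex_cauchy_cvg => eps eps0.
  have d0 : 0 < eps / 4 / (C + 1) by rewrite !divr_gt0// ltr_wpDl.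
  have := in_setT x; rewrite -etot inE.
  move=> /(_ _ (nbhsx_ballx x _ d0))[_ [[k [c [i ->]]]]].
  set y := \sum_j _; rewrite -ball_normE /= => xy.
  have : cvgn (fun n => dot y (v n) : R[i]^o).
    rewrite /y; elim/big_rec: _ => [|j a _ /cvg_ex[/= l al]].
      by under eq_fun do rewrite dot0l; exact: is_cvg_cst.
    under eq_fun do rewrite dot_linear.
    by apply: cvgP; exact: (cvg_lincomb (ecv _) al).
  move=> /cvg_ex[l /cvgrPdist_le/(_ (eps / 4))[|N _ yl]]; first by rewrite divr_gt0.
  exists N => m n Nm Nn.
  have xyv p : `|dot x (v p) - dot y (v p)| <= eps / 4.
    rewrite -dotBl (le_trans (dotvC _ _))//.
    rewrite (le_trans (ler_wpM2l C0 (ltW xy)))// (mulrA C) ler_pdivrMr ?ltr_wpDl//.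
    by rewrite mulrC ler_wpM2l ?lerDl// ltW// divr_gt0.
  have -> : dot x (v m) - dot x (v n) = (dot x (v m) - dot y (v m)) -
    (l - dot y (v m)) + ((l - dot y (v n)) - (dot x (v n) - dot y (v n))) by ring.
  rewrite (splitr eps) (le_trans (ler_normD _ _))// lerD//.
  - rewrite (le_trans (ler_normB _ _))//.
    rewrite (le_trans (lerD (xyv m) (yl m Nm)))//; rewrite le_eqVlt; apply/orP; left.
    by apply/eqP; field.
  - rewrite (le_trans (ler_normB _ _))//.
    rewrite (le_trans (lerD (yl n Nn) (xyv n)))//; rewrite le_eqVlt; apply/orP; left.
    by apply/eqP; field.
have [||w wE] := @riesz R H (fun x => limn (fun n => dot x (v n) : R[i]^o)) C.
- move=> a x y; apply: (@cvg_lim R[i]^o) => //; under eq_fun do rewrite dot_linear.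
  exact: (cvg_lincomb (cv x) (cv y)).
- by move=> x; apply: cvg_norm_le (dotvC x); exact: cv.
by exists w => x; rewrite -wE; exact: cv.
Qed.

(** [weak_limit] is used twice.  Applied to [S n (e j)] it gives the convergence of
    [dot (T n x) (e j)] for every [x], which is what is needed to apply it again,
    to [T n x]. *)
Lemma wot_limit (I : Type) (e : I -> H) (T S : nat -> H -> H) :
  total_family e ->
  (forall n x y, dot (T n x) y = dot x (S n y)) ->
  (forall n x, `|T n x| <= `|x|) -> (forall n x, `|S n x| <= `|x|) ->
  (forall i j, cvgn (fun n => dot (T n (e i)) (e j) : R[i]^o)) ->
  exists2 E, bounded_operator E & wot_cvg T E.
Proof.
move=> etot adj Tle Sle ecv.
have Ex x : exists w, forall y,
    (fun n => dot y (T n x) : R[i]^o) @ \oo --> (dot y w : R[i]^o).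
  apply: (weak_limit etot) => // j.
  have [i|w Sw] := weak_limit etot (Sle^~ (e j)).
    by under eq_fun do rewrite -adj; exact: ecv.
  under eq_fun do rewrite dot_conj adj.
  by apply: cvgP; apply: cvg_conjC; exact: Sw.
have [E EP] := choice Ex.
have EW : wot_cvg T E.
  move=> x y; rewrite dot_conj; under eq_fun do rewrite dot_conj.
  exact/cvg_conjC/EP.
have Elin : linear E.
  move=> a x y; apply: dot_inj => z.
  apply: (@cvg_unique _ (@norm_hausdorff _ R[i]^o) _ _ _ _ (EP _ z)).
  rewrite dotDr dotZr.
  rewrite (_ : (fun n => _) = (fun n => a^* * dot z (T n x) + dot z (T n y))).
    exact: cvg_lincomb (EP x z) (EP y z).
  apply/funext => n; rewrite dot_conj adj dot_linear rmorphD rmorphM /=.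
  by rewrite -!adj -!dot_conj.
have Ele x : `|E x| <= `|x|.
  have [->|E0] := eqVneq (E x) 0; first by rewrite normr0.
  have Ep : 0 < `|E x| by rewrite normr_gt0.
  rewrite -(ler_pM2l Ep) -expr2 -dot_norm -[leLHS]ger0_norm; last first.
    by rewrite dot_norm exprn_ge0.
  apply: (cvg_norm_le (EP x (E x))) => n.
  by rewrite (le_trans (cauchy_schwarz _ _))// ler_wpM2l.
exists E => //; split => // x; apply/cvgrPdist_le => eps eps0.
have /cvgrPdist_le/(_ _ eps0) := @cvg_id _ (nbhs x).
apply: filterS => y; apply: le_trans.
by rewrite [E x - _]addrC -[- E y]scaleN1r -Elin scaleN1r addrC.
Qed.

(** Weak operator convergence only speaks of functionals [dot _ y]; this lemma says
    that [dot (S _) y] is one of them. *)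
Lemma bounded_operator_adjoint (S : H -> H) y : bounded_operator S ->
  exists z, forall x, dot (S x) y = dot x z.
Proof.
move=> [Slin Scont].
pose S' : {linear H -> H} := HB.pack S (GRing.isLinear.Build _ _ _ _ S Slin).
have Sc : continuous S' by [].
have /linear_bounded_continuous/linear_boundedP/pinfty_ex_gt0[C C0 SC] := Sc.
apply: (@riesz R H (fun x => dot (S x) y) (C * `|y|)).
- by move=> a u v; rewrite Slin dot_linear.
- by move=> x; rewrite (le_trans (cauchy_schwarz _ _))// mulrAC ler_wpM2r.
Qed.

(** Composition with a fixed bounded operator, on either side, is continuous for
    the weak operator topology, so commutation passes to weak limits. *)
Lemma wot_cvg_commute (T : nat -> H -> H) (E S : H -> H) :
  wot_cvg T E -> bounded_operator S ->
  (\forall n \near \oo, T n \o S = S \o T n) -> E \o S = S \o E.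
Proof.
move=> TE Sb TS; apply/funext => x /=; apply: dot_inj => y.
rewrite dot_conj [RHS]dot_conj; congr (_^*).
have [z Sz] := bounded_operator_adjoint y Sb; rewrite Sz.
apply: (@cvg_unique _ (@norm_hausdorff _ R[i]^o) _ _ _ _ (TE (S x) y)).
apply: cvg_trans (TE x z); apply: near_eq_cvg.
by apply: filterS TS => n /(congr1 (@^~ x)) /= ->; rewrite Sz.
Qed.

End WeakLimits.

(** * Supports in the wreath product *)

Section WreathSupport.
Variable G : groupType.
Implicit Types g h : wreath G.
Local Open Scope group_scope.

Definition fixes g (i : nat) : Prop := g.1 i = 1 /\ g.2 i = i.

Lemma fixes_far g : exists N, forall i, (N <= i)%N -> fixes g i.
Proof.
have : finite_set ([set i | g.1 i != 1] `|` [set i | g.2 i != i]).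
  by rewrite finite_setU; split; [exact: finseq_fin|exact: Sinf_fin].
move=> /finite_seqP[s sE]; exists (\max_(i <- s) i).+1 => i si.
have : ~ [set` s] i.
  by move=> /= i_s; have := leq_bigmax_seq (F := id) _ i_s isT; rewrite leqNgt si.
rewrite -sE => /not_orP[/negP + /negP].
by rewrite !negbK => /eqP ? /eqP.
Qed.

(** A position moved by [b.2] is sent by [b.2] to a position it also moves; hence
    each of two elements with disjoint supports preserves the support of the
    other. *)
Lemma wreath_commute g h : (forall i, fixes g i \/ fixes h i) -> g * h = h * g.
Proof.
move=> gh.
have invE (s : Sinf) i : s i = i -> Sinf_inv_fun s i = i.
  by move=> si; rewrite -[in LHS]si Sinf_funK.
have half (a b : wreath G) i : (forall j, fixes a j \/ fixes b j) -> fixes a i ->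
    a.1 i * b.1 (Sinf_inv_fun a.2 i) = b.1 i * a.1 (Sinf_inv_fun b.2 i) /\
    a.2 (b.2 i) = b.2 (a.2 i).
  move=> ab [ai si]; rewrite ai (invE _ _ si) si; split.
    have [[-> _]|[_]] := ab (Sinf_inv_fun b.2 i); first by rewrite mul1g mulg1.
    by rewrite Sinf_inv_funK => <-; rewrite ai mul1g mulg1.
  have [[_ ->]//|[_ /(bij_inj (Sinf_bij _)) ->]] := ab (b.2 i).
  by rewrite si.
have both i : g.1 i * h.1 (Sinf_inv_fun g.2 i) = h.1 i * g.1 (Sinf_inv_fun h.2 i) /\
    g.2 (h.2 i) = h.2 (g.2 i).
  have [gi|hi] := gh i; first exact: half.
  by have [||] := half h g i => //; first by move=> j; have [] := gh j; [right|left].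
rewrite [LHS](_ : _ = (g.1 * permute g.2 h.1, g.2 * h.2))//.
rewrite [RHS](_ : _ = (h.1 * permute h.2 g.1, h.2 * g.2))//.
by congr pair; [apply: finseqP|apply: SinfP] => i /=; have [] := both i.
Qed.

Lemma in_permM (s t : Sinf) : in_perm (s * t) = in_perm s * in_perm t :> wreath G.
Proof.
by rewrite [RHS](_ : _ = (1 * permute s 1, s * t))// permute_one mulg1.
Qed.

Lemma in_permV (s : Sinf) : in_perm s^-1 = (in_perm s)^-1 :> wreath G.
Proof. by apply: (mulgI (in_perm s)); rewrite -in_permM !mulgV. Qed.

Lemma fixes_in_perm (s : Sinf) i : s i = i -> fixes (in_perm s) i.
Proof. by []. Qed.

Lemma fixes_conj g (s : Sinf) i : fixes g (Sinf_inv_fun s i) ->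
  fixes (in_perm s * g * (in_perm s)^-1) i.
Proof.
move=> [g1 g2]; rewrite -in_permV.
rewrite [X in fixes X](_ : _ =
  (1 * permute s g.1 * permute (s * g.2) 1, s * g.2 * s^-1))//.
rewrite permute_one mulg1 mul1g; split => //.
by rewrite [LHS](_ : _ = s (g.2 (Sinf_inv_fun s i)))// g2 Sinf_inv_funK.
Qed.

(** The quotient [t^-1 * s] fixes the support of [g], hence commutes with [g]. *)
Lemma conj_agree g (s t : Sinf) : (forall i, fixes g i \/ s i = t i) ->
  in_perm s * g * (in_perm s)^-1 = in_perm t * g * (in_perm t)^-1.
Proof.
move=> st.
have /wreath_commute : forall i, fixes (in_perm (t^-1 * s)) i \/ fixes g i.
  move=> i; have [|sti] := st i; [by right|left]; apply: fixes_in_perm.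
  by rewrite [LHS](_ : _ = Sinf_inv_fun t (s i))// sti Sinf_funK.
rewrite in_permM in_permV => e.
apply: (mulIg (in_perm s)); rewrite mulgVK; apply: (mulgI (in_perm t)^-1).
by rewrite mulgA e !mulgA mulVg mul1g.
Qed.

Lemma omegaV n : (omega n)^-1 = omega n.
Proof.
by apply: (mulgI (omega n)); rewrite mulgV; apply: SinfP => i /=; rewrite omega_funK.
Qed.

End WreathSupport.

(** * The cyclic shift of a block *)

Section Shift.
Variables n N : nat.

(** The cycle [n -> n + 1 -> ... -> n + N -> n]: it agrees with
    [omega n.+1 * omega n] on [n, ..., n + N - 1] when [N <= n], but, unlike that
    product, it does not disturb the positions below [n]. *)
Definition shift_fun (i : nat) : nat :=
  if (i < n)%N then i else if (i < n + N)%N then i.+1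
  else if i == (n + N)%N then n else i.

Definition unshift_fun (i : nat) : nat :=
  if (i < n)%N then i else if i == n then (n + N)%N
  else if (i <= n + N)%N then i.-1 else i.

Lemma shift_funK : cancel shift_fun unshift_fun.
Proof. by move=> i; rewrite /shift_fun /unshift_fun; do !case: ifP; lia. Qed.

Lemma unshift_funK : cancel unshift_fun shift_fun.
Proof. by move=> i; rewrite /shift_fun /unshift_fun; do !case: ifP; lia. Qed.

Lemma shift_fin : finite_set [set i | shift_fun i != i].
Proof.
apply: (@sub_finite_set _ _ `I_((n + N).+1)) => //= i /=.
by rewrite /shift_fun; do !case: ifP; lia.
Qed.

Definition shift : Sinf := MkSinf (Bijective shift_funK unshift_funK) shift_fin.

End Shift.

(** * Conjugation by [omega n] for large [n] *)

Section OmegaConjugation.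
Variable G : groupType.
Implicit Types g h : wreath G.
Local Open Scope group_scope.

Lemma omega_conjE n g : in_perm (omega n) * g * in_perm (omega n) =
  in_perm (omega n) * g * (in_perm (omega n))^-1.
Proof. by rewrite -in_permV omegaV. Qed.

(** For large [n] the permutation [omega n] moves the support of [g] beyond that of
    [h]. *)
Lemma omega_conj_commute g h : exists N, forall n, (N <= n)%N ->
  in_perm (omega n) * g * in_perm (omega n) * h =
  h * (in_perm (omega n) * g * in_perm (omega n)).
Proof.
have [M gM] := fixes_far g; have [N hN] := fixes_far h.
exists (maxn M N) => n; rewrite geq_max => /andP[Mn Nn]; rewrite omega_conjE.
apply: wreath_commute => i; have [iN|Ni] := ltnP i N; last by right; exact: hN.
left; apply/fixes_conj/gM.
rewrite (_ : Sinf_inv_fun _ i = omega_fun n i); last first.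
  exact: (congr1 (@^~ i \o Sinf_fun) (omegaV n)).
by rewrite /omega_fun (leq_trans iN Nn) (leq_trans Mn)// leq_addl.
Qed.

End OmegaConjugation.

Section Central.
Variables (R : realType) (G : topologicalGroupType) (phi : wreath G -> R[i]).
Local Open Scope group_scope.

Lemma central_conj (s : Sinf) (g : wreath G) : Sinf_central phi ->
  phi (in_perm s * g * (in_perm s)^-1) = phi g.
Proof. by move=> phiC; rewrite -in_permV phiC in_permV mulgA mulVg mul1g. Qed.

(** Conjugation by [shift n L] turns [omega n * g * omega n] into the next element
    of the sequence without affecting [h] and [k], whose supports lie below [n]. *)
Lemma central_coef_stationary (g h k : wreath G) : Sinf_central phi ->
  exists N, forall n, (N <= n)%N ->
  phi (h * (in_perm (omega n) * g * in_perm (omega n)) * k) =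
  phi (h * (in_perm (omega N) * g * in_perm (omega N)) * k).
Proof.
move=> phiC.
have [L gL] := fixes_far g; have [M hM] := fixes_far h; have [N kN] := fixes_far k.
exists (maxn L (maxn M N)); elim=> [|n IHn].
  by rewrite leqn0 => /eqP ->.
rewrite leq_eqVlt => /predU1P[<-//|]; rewrite ltnS => /[dup] Kn /IHn <-.
move: Kn; rewrite !geq_max => /and3P[Ln Mn Nn].
set t := shift n L; set gn := _ * g * _; set gn' := _ * g * _.
have far (x : wreath G) P : (forall i, (P <= i)%N -> fixes x i) -> (P <= n)%N ->
    in_perm t * x = x * in_perm t.
  move=> xP Pn; apply: wreath_commute => i.
  have [Pi|iP] := leqP P i; [right; exact: xP|left; apply: fixes_in_perm].
  by rewrite /= /shift_fun (leq_trans iP Pn).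
have gnE : in_perm t * gn' * (in_perm t)^-1 = gn.
  rewrite /gn /gn' !omega_conjE.
  rewrite -(@conj_agree _ g (t * omega n) (omega n.+1)) => [|i].
    by rewrite in_permM invgM !mulgA.
  have [Li|iL] := leqP L i; [by left; exact: gL|right].
  rewrite [LHS](_ : _ = shift_fun n L (omega_fun n i))// /= /shift_fun /omega_fun.
  by do !case: ifP; lia.
have tk : (in_perm t)^-1 * k = k * (in_perm t)^-1.
  by apply: (mulgI (in_perm t)); rewrite mulgA mulgV mul1g mulgA (far k N)// mulgK.
by rewrite -gnE -[RHS](central_conj t _ phiC) !mulgA (far h M)// -!mulgA tk.
Qed.

End Central.

(** * Weak limits of unitary operators in a factor *)

Section UnitaryRep.
Variables (W : groupType) (R : realType) (H : hilbertType R) (pi : unitary_rep W H).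

Lemma rep_adjoint g x y : dot (pi g x) y = dot x (pi g^-1%g y).
Proof. by rewrite -(rep_dot pi g^-1%g) -rep_mul mulVg rep_one. Qed.

Lemma rep_norm g x : `|pi g x| = `|x|.
Proof. by apply/eqP; rewrite -(@eqrXn2 _ 2)// -!dot_norm rep_dot. Qed.

Lemma rep_bounded g : bounded_operator (pi g).
Proof.
split; first exact: linearP.
move=> x; apply/cvgrPdist_le => e e0.
have /cvgrPdist_le/(_ _ e0) := @cvg_id _ (nbhs x).
by apply: filterS => y; rewrite -linearB rep_norm.
Qed.

(** [E] commutes with the commutant of [pi], since each [pi (g_ n)] does, and with
    [pi] itself by asymptotic centrality, so it belongs to the centre. *)
Lemma asymptotically_central_wot_limit (g_ : nat -> W) (E : H -> H) :
  is_factor (vN_algebra pi) -> bounded_operator E ->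
  wot_cvg (fun n => pi (g_ n)) E ->
  (forall h, \forall n \near \oo, (g_ n * h = h * g_ n)%g) ->
  exists a : R[i], E = ( *:%R a).
Proof.
move=> factor Eb gE gh.
suff : (vN_algebra pi `&` commutant (vN_algebra pi)) E by rewrite factor.
have Ecomm : commutant (range (fun g => pi g : H -> H)) E.
  split=> // _ [h _ <-]; apply: wot_cvg_commute gE (rep_bounded h) _.
  apply: filterS (gh h) => n gnh.
  by apply/funext => x /=; rewrite -!rep_mul gnh.
split; split => // A; last by move=> [_ /(_ _ Ecomm)].
move=> [Ab Api]; apply: (wot_cvg_commute gE Ab).
by apply: nearW => n; rewrite Api//; exists (g_ n).
Qed.

End UnitaryRep.

(** * The limit of the conjugates by [omega n] *)

Theorem lemma6 (R : realType) (G : topologicalGroupType) (phi : wreath G -> R[i])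
    (pi_phi : GNS phi) :
  separable G -> is_state phi -> Sinf_central phi -> indecomposable pi_phi ->
  forall g : wreath G,
    wot_cvg (fun n => pi_phi (in_perm (omega n) * g * in_perm (omega n))%g)
            (fun x => phi g *: x).
Proof.
move=> _ [_ _ phi1] phiC factor g.
pose g_ n : wreath G := (in_perm (omega n) * g * in_perm (omega n))%g.
have coefE h k l : dot (pi_phi l (pi_phi h (gns_vector pi_phi)))
    (pi_phi k (gns_vector pi_phi)) = phi (k^-1 * l * h)%g.
  by rewrite (gns_coef pi_phi) !rep_mul [RHS]rep_adjoint invgK.
have [|||||E Eb gE] := @wot_limit R _ _ (fun h => pi_phi h (gns_vector pi_phi))
  (fun n => pi_phi (g_ n)) (fun n => pi_phi (g_ n)^-1%g).
- exact: gns_cyclic.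
- by move=> n x y; exact: rep_adjoint.
- by move=> n x; rewrite rep_norm.
- by move=> n x; rewrite rep_norm.
- move=> h k; have [N gN] := central_coef_stationary g k^-1%g h phiC.
  apply/cvg_ex; exists (phi (k^-1 * g_ N * h)%g : R[i]^o).
  apply: cvg_near_cst; exists N => // n /= Nn.
  by rewrite coefE gN.
have [|a Ea] := @asymptotically_central_wot_limit _ _ _ pi_phi g_ E factor Eb gE.
  by move=> h; have [N hN] := omega_conj_commute g h; exists N.
suff -> : phi g = a by rewrite Ea in gE.
have := gE (gns_vector pi_phi) (gns_vector pi_phi).
under eq_fun do rewrite -(gns_coef pi_phi) /g_ omega_conjE central_conj//.
rewrite Ea dotZl -[X in dot X _](rep_one pi_phi) -(gns_coef pi_phi) phi1 mulr1.
move=> /(@cvg_unique _ (@norm_hausdorff _ R[i]^o) _ _ _ _) aE.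
by apply/esym/aE; exact: cvg_cst.
Qed.
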